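(* Let $\alpha$ be a probability on $\mathbb{R}$ having a mean, that is $\int_{-\infty}^{+\infty}|x|\,\alpha(dx)<\infty$. If for some fixed $b$ and $c$ with $0\le b<c$ we have $\mu(b\alpha)=\mu(c\alpha)$, then $\alpha$ is Dirac, i.e. $\alpha=\delta_a$ for some $a\in\mathbb{R}$.
   Context: For a probability $\alpha$ on $\mathbb{R}$ with $\int\log(1+|x|)\alpha(dx)<\infty$ and $t>0$, let $B_1,Y_1,B_2,Y_2,\ldots$ be independent with $B_k\sim\alpha$ and $Y_k\sim\beta(1,t)$ (density $t(1-y)^{t-1}$ on $(0,1)$), and put $W_1=Y_1$, $W_k=Y_k(1-Y_{k-1})\cdots(1-Y_1)$ for $k>1$. The series $X_t=\sum_{k\ge1}W_kB_k$ converges absolutely almost surely, and $\mu(t\alpha)$ denotes its distribution (it is the law of $\int x\,P_t(dx)$ for a Dirichlet random probability $P_t=\sum_k W_k\delta_{B_k}\sim\mathcal{D}(t\alpha)$). For $t=0$ the convention is $\mu(0\cdot\alpha)=\alpha$, which is the weak limit of $\mu(t\alpha)$ as $t\searrow0$. *)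

(* Defs.v *)
From HB Require Import structures.
From mathcomp Require Import all_boot all_order all_algebra.
From mathcomp Require Import all_classical all_reals all_analysis.

Set Implicit Arguments.
Unset Strict Implicit.
Unset Printing Implicit Defensive.

Import Order.TTheory GRing.Theory Num.Theory.
Import numFieldNormedType.Exports.

Local Open Scope classical_set_scope.
Local Open Scope ring_scope.

(* Measures are functions on all sets, with arbitrary values outside the
   sigma-algebra; two laws are the same when they agree on Borel sets. *)
Definition same_law (R : realType) (m1 m2 : set R -> \bar R) : Prop :=
  forall A : set R, measurable A -> m1 A = m2 A.

Definition mutually_independent (d : measure_display) (T : measurableType d)
    (R : realType) (P : probability T R) (I : eqType)
    (Z : I -> {RV P >-> R}) : Prop :=
  forall (J : seq I) (A : I -> set R),
    uniq J -> (forall i, measurable (A i)) ->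
    P (\bigcap_(i in [set` J]) (Z i @^-1` A i))
      = (\prod_(i <- J) P (Z i @^-1` A i))%E.

(* The library's beta_prob only has natural number parameters. *)
Definition beta1_law (R : realType) (t : R) (A : set R) : \bar R :=
  (\int[lebesgue_measure]_(y in A `&` `]0%R, 1%R[)
     (t * (1 - y) `^ (t - 1))%:E)%E.

(* Indices start at 0. *)
Definition stick_weight (R : realType) (Y : nat -> R) (k : nat) : R :=
  Y k * \prod_(j < k) (1 - Y j).

Definition stick_breaking_law (R : realType) (t : R) (alpha nu : probability R R)
    : Prop :=
  exists (d : measure_display) (T : measurableType d) (P : probability T R)
         (B Y : nat -> {RV P >-> R}) (X : {RV P >-> R}),
    [/\ mutually_independent
          (fun i : nat + nat => match i with inl k => B k | inr k => Y k end),
        forall k, same_law (distribution P (B k)) alpha,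
        forall k, same_law (distribution P (Y k)) (beta1_law t),
        {ae P, forall w,
           series (fun k => stick_weight (fun j => Y j w) k * B k w) n
             @[n --> \oo] --> X w}
      & same_law (distribution P X) nu].

(* [is_mu t alpha nu] says that nu is mu(t alpha). It is a relation because
   the law is specified through some realization of the B_k and Y_k; as their
   joint law is prescribed, nu is determined up to [same_law]. *)
Definition is_mu (R : realType) (t : R) (alpha nu : probability R R) : Prop :=
  (t = 0 /\ same_law nu alpha) \/ (0 < t /\ stick_breaking_law t alpha nu).

(* Main.v *)
(* The stick-breaking series satisfies X = Y_1 B_1 + (1 - Y_1) X' in law, with
   X' a copy of X independent of Y_1 and B_1. Hence, for f strictly convex of
   linear growth and h(y) = E f(y B + (1 - y) X) with B and X independent of
   laws alpha and mu(t alpha), the convex function D = h - h(0) satisfies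
   int_0^1 D(y) (1 - y)^(t-1) dy = 0.
   If mu(b alpha) = mu(c alpha), the same D works for t = b and t = c. By
   convexity and D(0) = 0, D is <= 0 before some y0 and >= 0 after it, so
   D(y) ((1 - y0)^(c-b) - (1 - y)^(c-b)) is >= 0, while its integral against
   (1 - y)^(b-1) vanishes. Thus D = 0 a.e., and equality in the convexity
   inequality gives X = B a.s.; as they are independent, alpha is Dirac.
   For b = 0, X and B have the same law, so D(1) = 0 and one takes y0 = 1. *)
Require Import Defs.
From HB Require Import structures.
From mathcomp Require Import all_boot all_order all_algebra.
From mathcomp Require Import all_classical all_reals all_analysis.
From mathcomp Require Import measurable_realfun.
From mathcomp Require Import ring lra.

Set Implicit Arguments.
Unset Strict Implicit.
Unset Printing Implicit Defensive.

Import Order.TTheory GRing.Theory Num.Theory.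
Import numFieldNormedType.Exports.

Local Open Scope classical_set_scope.
Local Open Scope ring_scope.

(** * The strictly convex test function *)

(** The f of the introductory comment: strictly convex, continuous, minimal at 0, and of linear
    growth, hence integrable as soon as |x| is. *)
Definition bracket (R : realType) (x : R) : R := Num.sqrt (1 + x ^+ 2).

Lemma bracket_sqr (R : realType) (x : R) : bracket x ^+ 2 = 1 + x ^+ 2.
Proof. by rewrite sqr_sqrtr// addr_ge0// sqr_ge0. Qed.

Lemma bracket_ge1 (R : realType) (x : R) : 1 <= bracket x.
Proof. by rewrite -[leLHS]sqrtr1 ler_wsqrtr// lerDl sqr_ge0. Qed.

Lemma bracket_le (R : realType) (x : R) : bracket x <= 1 + `|x|.
Proof.
have := normr_ge0 x; have := real_normK (num_real x); set a := `|x| => ax a0.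
have := bracket_sqr x; rewrite -ax; have := bracket_ge1 x.
move: (bracket x) => s; nra.
Qed.

Lemma continuous_bracket (R : realType) : continuous (@bracket R).
Proof.
move=> x; apply: continuous_comp; last exact: sqrt_continuous.
by apply: cvgD; [exact: cvg_cst|exact: exprn_continuous].
Qed.

(** After squaring, the difference of the two sides is 2 s (1 - s) (p q - 1 - x z) with p and q the
    values at x and z. It is nonnegative by Cauchy-Schwarz for the vectors (1, x) and (1, z). *)
Lemma bracket_convex (R : realType) (s x z : R) : 0 <= s <= 1 ->
  bracket (s * x + (1 - s) * z) <= s * bracket x + (1 - s) * bracket z.
Proof.
move=> /andP[s0 s1].
have := bracket_sqr (s * x + (1 - s) * z); have := bracket_sqr z.
have := bracket_sqr x; have := bracket_ge1 (s * x + (1 - s) * z).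
have := bracket_ge1 x; have := bracket_ge1 z.
move: (bracket x) (bracket z) (bracket (s * x + (1 - s) * z)) =>
  p q r q1 p1 r1 pE qE rE.
have pq1 : 1 <= p * q by exact: mulr_ege1.
have pq : 1 + x * z <= p * q.
  rewrite leNgt; apply/negP => lt.
  have : (p * q) ^+ 2 < (1 + x * z) ^+ 2 by rewrite ltr_pXn2r// nnegrE; lra.
  rewrite exprMn pE qE; have := sqr_ge0 (x - z); nra.
rewrite leNgt; apply/negP => lt.
have : 0 <= s * (1 - s) * (p * q - 1 - x * z) by rewrite mulr_ge0//; nra.
have : (s * p + (1 - s) * q) ^+ 2 < r ^+ 2.
  by rewrite ltr_pXn2r// nnegrE; nra.
rewrite rE sqrrD !exprMn pE qE; nra.
Qed.

(** Equality forces p q = 1 + x z, the equality case of Cauchy-Schwarz, and (p q)^2 - (1 + x z)^2 =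
    (x - z)^2. *)
Lemma bracket_strict (R : realType) (s x z : R) : 0 < s < 1 ->
  bracket (s * x + (1 - s) * z) = s * bracket x + (1 - s) * bracket z ->
  x = z.
Proof.
move=> /andP[s0 s1].
have := bracket_sqr (s * x + (1 - s) * z); have := bracket_sqr z.
have := bracket_sqr x; have := bracket_ge1 x; have := bracket_ge1 z.
move: (bracket x) (bracket z) (bracket (s * x + (1 - s) * z)) =>
  p q r q1 p1 pE qE rE r_eq.
have pqE : p * q = 1 + x * z.
  have s1s : s * (1 - s) != 0 by rewrite mulf_neq0// gt_eqF// subr_gt0.
  apply: (mulfI s1s); move: rE; rewrite r_eq sqrrD !exprMn pE qE; nra.
have : (p * q) ^+ 2 = (1 + x ^+ 2) * (1 + z ^+ 2) by rewrite exprMn pE qE.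
rewrite pqE => xz.
have : (x - z) ^+ 2 = 0 by nra.
by move/eqP; rewrite sqrf_eq0 subr_eq0 => /eqP.
Qed.

(** * Integration against beta(1, t) *)

Definition beta1_density (R : realType) (t y : R) : R := t * (1 - y) `^ (t - 1).

Lemma measurable_beta1_density (R : realType) (t : R) :
  measurable_fun [set: R] (beta1_density t).
Proof.
apply: measurable_funM => //.
apply: (@measurableT_comp _ _ _ _ _ _ (@powR R ^~ (t - 1))).
  exact: measurable_powR.
exact: measurable_funB.
Qed.

(** [m] is dominated by Lebesgue measure, and its Radon-Nikodym derivative has the same integrals
    over measurable sets as the density extended by 0. The two therefore agree almost everywhere,
    and the change of variables formula applies. *)
Lemma integral_beta1_law (R : realType) (t : R) (m : probability R R)
    (phi : R -> \bar R) : 0 < t -> same_law m (beta1_law t) ->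
  measurable_fun [set: R] phi -> (forall y, 0 <= phi y)%E ->
  (\int[m]_y phi y =
   \int[lebesgue_measure]_(y in `]0%R, 1%R[)
     (phi y * (beta1_density t y)%:E))%E.
Proof.
move=> t0 mE mphi phi0.
pose w (y : R) := (beta1_density t y)%:E.
have mw : measurable_fun [set: R] w.
  by apply/measurable_EFinP; exact: measurable_beta1_density.
pose g : R -> \bar R := w \_ `]0, 1[.
have mg : measurable_fun [set: R] g.
  by apply/measurable_restrict => //; exact: measurable_funTS.
have mgE A : measurable A -> m A = (\int[lebesgue_measure]_(y in A) g y)%E.
  by move=> mA; rewrite mE// /beta1_law integral_mkcondr.
(* [lebesgue_measure] lives on [measurableTypeR R], whose measurable sets are
   those of R but whose display is not, so m is moved there first. *)
pose toR (x : R) : measurableTypeR R := x.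
have mtoR : measurable_fun [set: R] toR by move=> _ B mB; rewrite setTI.
pose toRm : {mfun R >-> measurableTypeR R} :=
  HB.pack toR (isMeasurableFun.Build _ _ _ _ toR mtoR).
pose leb : {sigma_finite_measure set (measurableTypeR R) -> \bar R} :=
  @lebesgue_measure R.
pose m' : {finite_measure set (measurableTypeR R) -> \bar R} :=
  distribution m toRm.
have -> : (\int[m]_y phi y = \int[m']_y phi y)%E.
  by rewrite /m' ge0_integral_distribution.
have dom : m' `<< leb.
  apply/null_content_dominatesP => A mA A0.
  rewrite /m' /distribution /pushforward /= [LHS]mgE//.
  by apply: null_set_integral => //; exact: measurable_funTS.
rewrite -(Radon_Nikodym_SigmaFinite.change_of_variables dom)//.
rewrite [RHS]integral_mkcond; apply: ge0_ae_eq_integral => //.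
- apply: emeasurable_funM => //.
  exact: measurable_int (Radon_Nikodym_SigmaFinite.f_integrable dom).
- apply/measurable_restrict => //; apply: measurable_funTS.
  exact: emeasurable_funM.
- by move=> x _; rewrite mule_ge0// Radon_Nikodym_SigmaFinite.f_ge0.
- move=> x _; rewrite patchE; case: ifPn => // _.
  by rewrite mule_ge0// lee_fin mulr_ge0 ?powR_ge0// ltW.
have : ae_eq leb setT (Radon_Nikodym_SigmaFinite.f m' leb) g.
  apply: integral_ae_eq => //; first exact: Radon_Nikodym_SigmaFinite.f_integrable.
  move=> A _ mA; rewrite -(Radon_Nikodym_SigmaFinite.f_integral dom)//.
  by rewrite /m' /distribution /pushforward /= [LHS]mgE.
apply: filterS => x /= /(_ I) -> _; rewrite /g !patchE.
by case: ifPn => //; rewrite mule0.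
Qed.

(** * Independence of one variable from all the others *)

(** A pi-system generating the sigma-algebra of the variables other than [Z i0], made of the finite
    intersections to which [mutually_independent] applies. *)
Definition cylinders_avoiding (d : measure_display) (T : measurableType d)
    (R : realType) (I : eqType) (Z : I -> T -> R) (i0 : I) : set (set T) :=
  [set E | exists (J : seq I) (A : I -> set R),
     [/\ uniq J, i0 \notin J, forall i, measurable (A i) &
         E = \bigcap_(i in [set` J]) (Z i @^-1` A i)]].

Lemma setI_closed_cylinders_avoiding (d : measure_display)
    (T : measurableType d) (R : realType) (I : eqType) (Z : I -> T -> R)
    (i0 : I) : setI_closed (cylinders_avoiding Z i0).
Proof.
move=> _ _ [J1 [A1 [J1u J1i mA1 ->]]] [J2 [A2 [J2u J2i mA2 ->]]].
exists (undup (J1 ++ J2)), (fun i => (if i \in J1 then A1 i else setT) `&`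
  (if i \in J2 then A2 i else setT)); split.
- exact: undup_uniq.
- by rewrite mem_undup mem_cat negb_or J1i.
- by move=> i; apply: measurableI; case: ifP.
- apply/seteqP; split => w /=.
    move=> [h1 h2] i _ /=; split.
      by case: ifPn => // /h1.
    by case: ifPn => // /h2.
  move=> h; split=> i /= iJ; have := h i; rewrite /= mem_undup mem_cat iJ ?orbT.
    by move=> /(_ isT)[].
  by move=> /(_ isT)[].
Qed.

(** Dynkin's argument: the measurable sets E satisfying the product formula form a lambda-system
    that contains the pi-system of cylinders. *)
Lemma mutually_independent_sigma (d : measure_display) (T : measurableType d)
    (R : realType) (P : probability T R) (I : eqType) (Z : I -> {RV P >-> R})
    (i0 : I) (A : set R) (E : set T) :
  mutually_independent Z -> measurable A ->
  <<s cylinders_avoiding (fun i => Z i : T -> R) i0 >> E ->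
  measurable E /\ P (Z i0 @^-1` A `&` E) = (P (Z i0 @^-1` A) * P E)%E.
Proof.
move=> indZ mA.
have mZA : measurable (Z i0 @^-1` A) by exact: measurable_funPTI.
pose H := [set E : set T | measurable E /\
  P (Z i0 @^-1` A `&` E) = (P (Z i0 @^-1` A) * P E)%E].
suff: <<s cylinders_avoiding (fun i => Z i : T -> R) i0 >> `<=` H by exact.
apply: (lambda_system_subset (@setI_closed_cylinders_avoiding _ _ _ _ _ _));
  [|move=> _ [J [B [Ju Ji mB ->]]]|by []].
- apply/dynkin_lambda_system; split => /=.
  + by split => //; rewrite setIT probability_setT mule1.
  + move=> F [mF PF]; split; first exact: measurableC.
    rewrite -setDE measureD// ?ltey_eq ?fin_num_measure//.
    rewrite probability_setC// muleBr ?fin_num_measure// ?mule1 ?PF//.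
    by congr (_ - _)%E; exact: PF.
  + move=> F tF HF; have mF k := (HF k).1.
    have mUF : measurable (\bigcup_k F k) by exact: bigcup_measurable.
    split => //; rewrite setI_bigcupr measure_semi_bigcup//; last 3 first.
    * by move=> k; exact: measurableI.
    * exact: trivIset_setIl.
    * by rewrite -setI_bigcupr; exact: measurableI.
    rewrite measure_semi_bigcup// -(@fineK _ (P (Z i0 @^-1` A))) ?fin_num_measure//.
    rewrite -nneseriesZl//; apply: eq_eseriesr => k _.
    by rewrite fineK ?fin_num_measure//; exact: (HF k).2.
- split.
    apply: fin_bigcap_measurable => // i _.
    by apply: measurable_funPTI => //; exact: mB.
  (* Placing [A] at index [i0] turns the claim into independence along the list [i0 :: J]. *)
  pose B' i := if i == i0 then A else B i.
  have mB' i : measurable (B' i) by rewrite /B'; case: ifP.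
  have B'i0 : B' i0 = A by rewrite /B' eqxx.
  have BB' i : i \in J -> B' i = B i.
    by move=> iJ; rewrite /B'; case: eqP => // ii0; move: Ji; rewrite -ii0 iJ.
  have /= := indZ (i0 :: J) B'; rewrite Ji Ju => /(_ isT mB').
  
  have -> : [set` i0 :: J] = i0 |` [set` J].
    by apply/seteqP; split => i /=; rewrite inE; [case/predU1P; [left|right]|
      move=> [->|->]; rewrite ?eqxx ?orbT].
  rewrite bigcap_setU1 big_cons B'i0.
  rewrite (eq_big_seq (fun i => P (Z i @^-1` B i))); last by move=> i /BB' ->.
  rewrite -indZ// (@eq_bigcapr _ _ _ (fun i => Z i @^-1` B' i)
    (fun i => Z i @^-1` B i)) => [|i iJ].
    exact.
  by rewrite BB'.
Qed.

Lemma measurable_avoiding (d : measure_display) (T : measurableType d)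
    (R : realType) (I : eqType) (Z : I -> T -> R) (i0 i : I) : i != i0 ->
  measurable_fun [set: g_sigma_algebraType (cylinders_avoiding Z i0)] (Z i).
Proof.
move=> ii0 _ A mA; rewrite setTI; apply: sub_sigma_algebra.
exists [:: i], (fun=> A); split => //; first by rewrite inE eq_sym.
by rewrite set_cons1 bigcap_set1.
Qed.

(** Since V depends only on the other variables, the pair ([Z i0], V) has the product of its
    marginals as law, by uniqueness on rectangles; Tonelli then separates the two integrals. *)
Lemma integral_independent (d d' : measure_display) (T : measurableType d)
    (T' : measurableType d') (R : realType) (P : probability T R) (I : eqType)
    (Z : I -> {RV P >-> R}) (i0 : I) (V : T -> T') (F : R * T' -> \bar R) :
  mutually_independent Z ->
  measurable_fun [set: g_sigma_algebraType
    (cylinders_avoiding (fun i => Z i : T -> R) i0)] V ->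
  measurable_fun [set: R * T'] F -> (forall x, 0 <= F x)%E ->
  (\int[P]_w F (Z i0 w, V w) =
   \int[distribution P (Z i0)]_z \int[P]_w F (z, V w))%E.
Proof.
move=> indZ mV mF F0.
have sV B : measurable B -> <<s cylinders_avoiding (fun i => Z i : T -> R) i0 >>
    (V @^-1` B) by move=> mB; have := mV measurableT B mB; rewrite setTI.
have mVT : measurable_fun [set: T] V.
  move=> _ B mB; rewrite setTI.
  by have [] := mutually_independent_sigma indZ (@measurableT _ R) (sV _ mB).
pose V' : {mfun T >-> T'} := HB.pack V (isMeasurableFun.Build _ _ _ _ V mVT).
have mZV : measurable_fun [set: T] (fun w => (Z i0 w, V w)).
  exact: measurable_fun_pair.
pose ZV : {mfun T >-> (R * T')%type} :=
  HB.pack (fun w => (Z i0 w, V w)) (isMeasurableFun.Build _ _ _ _ _ mZV).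
have -> : (\int[P]_w F (Z i0 w, V w) = \int[distribution P ZV]_x F x)%E.
  by rewrite ge0_integral_distribution.
rewrite (eq_measure_integral (distribution P (Z i0) \x distribution P V')%E).
  rewrite fubini_tonelli1//; apply: eq_integral => z _.
  rewrite /fubini_F ge0_integral_distribution//.
  exact: measurableT_comp.
move=> A mA _; symmetry.
apply: product_measure_unique => //= B C mB mC.
exact: (mutually_independent_sigma indZ mB (sV _ mC)).2.
Qed.

(** * Partial sums of the stick-breaking series *)

Definition stick_sum (R : realType) (Y B : nat -> R) (n : nat) : R :=
  \sum_(j < n) stick_weight Y j * B j.

(** Removing the first stick, rather than the last, leaves the same kind of sum for the shifted
    sequences, scaled by 1 - Y 0. This is the finite form of X = Y_1 B_1 + (1 - Y_1) X'. *)
Lemma stick_sumS (R : realType) (Y B : nat -> R) (n : nat) :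
  stick_sum Y B n.+1 =
  Y 0%N * B 0%N + (1 - Y 0%N) * stick_sum (fun j => Y j.+1) (fun j => B j.+1) n.
Proof.
rewrite /stick_sum big_ord_recl /stick_weight big_ord0 mulr1; congr (_ + _).
rewrite mulr_sumr; apply: eq_bigr => j _; rewrite big_ord_recl /=.
by rewrite /bump /= add1n; ring.
Qed.

Lemma measurable_stick_sum (d : measure_display) (T : measurableType d)
    (R : realType) (Y B : nat -> T -> R) (n : nat) :
  (forall j, measurable_fun [set: T] (Y j)) ->
  (forall j, measurable_fun [set: T] (B j)) ->
  measurable_fun [set: T] (fun w => stick_sum (Y ^~ w) (B ^~ w) n).
Proof.
move=> mY mB; apply: measurable_sum => j.
apply: measurable_funM => //; apply: measurable_funM => //.
by apply: measurable_prod => i _; apply: measurable_funB.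
Qed.

(** * Limits under the integral sign *)

Lemma bounded_convergence (d : measure_display) (T : measurableType d)
    (R : realType) (P : probability T R) (f_ : nat -> T -> \bar R)
    (f : T -> \bar R) (M : R) :
  (forall n, measurable_fun [set: T] (f_ n)) -> measurable_fun [set: T] f ->
  (forall n x, 0 <= f_ n x <= M%:E)%E ->
  {ae P, forall x, f_ n x @[n --> \oo] --> f x} ->
  (\int[P]_x f_ n x)%E @[n --> \oo] --> (\int[P]_x f x)%E.
Proof.
move=> mf_ mf f_M f_f.
have [] // := @dominated_convergence _ _ _ P _ measurableT f_ f (cst M%:E) mf_ mf.
- by apply: filterS f_f => x + _.
- exact: finite_measure_integrable_cst.
- apply/aeW => x n _; have /andP[f0 fM] := f_M n x.
  by rewrite gee0_abs.
Qed.

Lemma monotone_cvg_integral (d : measure_display) (T : measurableType d)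
    (R : realType) (m : {measure set T -> \bar R}) (f_ : nat -> T -> \bar R)
    (f : T -> \bar R) :
  (forall n, measurable_fun [set: T] (f_ n)) ->
  (forall n x, 0 <= f_ n x)%E ->
  (forall x, {homo f_ ^~ x : n k / (n <= k)%N >-> (n <= k)%E}) ->
  (forall x, f_ n x @[n --> \oo] --> f x) ->
  (\int[m]_x f_ n x)%E @[n --> \oo] --> (\int[m]_x f x)%E.
Proof.
move=> mf_ f0 nd f_f.
have -> : (\int[m]_x f x = \int[m]_x limn (f_ ^~ x))%E.
  by apply: eq_integral => x _; apply/esym/cvg_lim.
by apply: cvg_monotone_convergence.
Qed.

(** * Means of f over mixtures of two independent variables *)

(** The function h of the introductory comment. Extended real values allow Tonelli to be used before
    finiteness is established. *)
Definition mixture_mean (R : realType) (f : R -> R) (alpha nu : probability R R)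
    (y : R) : \bar R :=
  (\int[alpha \x nu]_x (f (y * x.1 + (1 - y) * x.2))%:E)%E.

Section mixture_mean.
Context (R : realType) (f : R -> R) (alpha nu : probability R R).
Context (mf : measurable_fun [set: R] f) (f0 : forall x, 0 <= f x).

Lemma measurable_mix (y : R) : measurable_fun [set: R * R]
  (fun x : R * R => (f (y * x.1 + (1 - y) * x.2))%:E).
Proof.
apply/measurable_EFinP; apply: (measurableT_comp mf).
by apply: measurable_funD; apply: measurable_funM.
Qed.

Lemma measurable_mixture_mean : measurable_fun [set: R] (mixture_mean f alpha nu).
Proof.
pose F (z : R * (R * R)) := (f (z.1 * z.2.1 + (1 - z.1) * z.2.2))%:E.
have mF : measurable_fun setT F.
  apply/measurable_EFinP; apply: (measurableT_comp mf).
  apply: measurable_funD.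
    by apply: measurable_funM => //; exact: measurableT_comp.
  apply: measurable_funM; first exact: measurable_funB.
  exact: measurableT_comp.
have F0 z : (0 <= F z)%E by rewrite lee_fin.
pose prod : probability (R * R)%type R := (alpha \x nu)%E.
exact: (measurable_fun_fubini_tonelli_F (m2 := prod) F mF F0).
Qed.

Lemma mixture_mean_ge0 y : (0 <= mixture_mean f alpha nu y)%E.
Proof. by apply: integral_ge0 => x _; rewrite lee_fin. Qed.

Lemma mixture_meanE y : mixture_mean f alpha nu y =
  (\int[alpha]_b \int[nu]_x (f (y * b + (1 - y) * x))%:E)%E.
Proof.
rewrite /mixture_mean fubini_tonelli1//; first exact: measurable_mix.
by move=> x; rewrite lee_fin.
Qed.

Lemma mixture_mean0 : mixture_mean f alpha nu 0 = (\int[nu]_x (f x)%:E)%E.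
Proof.
rewrite mixture_meanE.
under eq_integral do (under eq_integral do rewrite mul0r add0r subr0 mul1r).
by rewrite integral_cst//= probability_setT mule1.
Qed.

Lemma mixture_mean1 : mixture_mean f alpha nu 1 = (\int[alpha]_x (f x)%:E)%E.
Proof.
rewrite mixture_meanE; apply: eq_integral => b _.
under eq_integral do rewrite mul1r subrr mul0r addr0.
by rewrite integral_cst//= probability_setT mule1.
Qed.

Context (f_convex : forall s x z, 0 <= s <= 1 ->
  f (s * x + (1 - s) * z) <= s * f x + (1 - s) * f z).

(** Convexity bounds the integrand at parameter s y by this one, because s y b + (1 - s y) x = s (y
    b + (1 - y) x) + (1 - s) x. *)
Let convex_bound s y (x : R * R) : \bar R :=
  (s%:E * (f (y * x.1 + (1 - y) * x.2))%:E + (1 - s)%:E * (f x.2)%:E)%E.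

Let integral_convex_bound s y : 0 <= s <= 1 ->
  (\int[alpha \x nu]_x convex_bound s y x =
   s%:E * mixture_mean f alpha nu y + (1 - s)%:E * mixture_mean f alpha nu 0)%E.
Proof.
move=> /andP[s0 s1]; rewrite /convex_bound.
have s0E : (0 <= s%:E)%E by rewrite lee_fin.
have s1E : (0 <= (1 - s)%:E)%E by rewrite lee_fin subr_ge0.
have mg := measurable_mix y.
have mk : measurable_fun [set: R * R] (fun x : R * R => (f x.2)%:E).
  by apply/measurable_EFinP; exact: measurableT_comp.
rewrite ge0_integralD//; last 4 first.
- by move=> x _; rewrite mule_ge0// lee_fin.
- exact: emeasurable_funM.
- by move=> x _; rewrite mule_ge0// lee_fin.
- exact: emeasurable_funM.
have fE0 (z : R) : (0 <= (f z)%:E)%E by rewrite lee_fin.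
rewrite (ge0_integralZl _ measurableT mg)// (ge0_integralZl _ measurableT mk)//.
congr (_ + _ * _)%E; apply: eq_integral => x _.
by rewrite mul0r add0r subr0 mul1r.
Qed.

Let convex_bound_ge s y x : 0 <= s <= 1 ->
  ((f (s * y * x.1 + (1 - s * y) * x.2))%:E <= convex_bound s y x)%E.
Proof.
move=> s01; rewrite /convex_bound -!EFinM -EFinD lee_fin.
apply: le_trans (f_convex _ _ s01).
by rewrite le_eqVlt; apply/orP; left; apply/eqP; congr f; ring.
Qed.

Let measurable_convex_bound s y : measurable_fun [set: R * R] (convex_bound s y).
Proof.
apply: emeasurable_funD.
  by apply: emeasurable_funM => //; exact: measurable_mix.
apply: emeasurable_funM => //; apply/measurable_EFinP; exact: measurableT_comp.
Qed.

Lemma mixture_mean_convex s y : 0 <= s <= 1 ->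
  (mixture_mean f alpha nu (s * y) <=
   s%:E * mixture_mean f alpha nu y + (1 - s)%:E * mixture_mean f alpha nu 0)%E.
Proof.
move=> s01; rewrite -integral_convex_bound//; apply: ge0_le_integral => //.
- by move=> x _; rewrite lee_fin.
- exact: measurable_mix.
- by move=> x _; exact: convex_bound_ge.
Qed.

(* Equality in the convexity inequality forces equality almost everywhere of
   the two integrands, hence of the two coordinates. *)
Lemma mixture_mean_strict s y :
  (forall s x z, 0 < s < 1 -> 
     f (s * x + (1 - s) * z) = s * f x + (1 - s) * f z -> x = z) ->
  0 < s < 1 -> y != 0 ->
  mixture_mean f alpha nu 0 \is a fin_num ->
  mixture_mean f alpha nu y \is a fin_num ->
  (mixture_mean f alpha nu (s * y) =
   s%:E * mixture_mean f alpha nu y + (1 - s)%:E * mixture_mean f alpha nu 0)%E ->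
  {ae (alpha \x nu)%E, forall x, x.1 = x.2}.
Proof.
move=> f_strict /andP[s0 s1] y0 fin0 finy.
have s01 : 0 <= s <= 1 by rewrite !ltW.
rewrite -integral_convex_bound// => eq_int.
pose g x := (f (s * y * x.1 + (1 - s * y) * x.2))%:E.
have mg : measurable_fun setT g by exact: measurable_mix.
have int_bound : (alpha \x nu)%E.-integrable setT (convex_bound s y).
  apply/integrableP; split; first exact: measurable_convex_bound.
  under eq_integral.
    move=> x _; rewrite gee0_abs; last first.
      by apply: le_trans (convex_bound_ge _ _ s01); rewrite lee_fin.
    over.
  rewrite integral_convex_bound// -ge0_fin_numE.
    by rewrite fin_numD !fin_numM.
  by rewrite adde_ge0// mule_ge0 ?mixture_mean_ge0// lee_fin ?ltW// subr_gt0.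
have int_g : (alpha \x nu)%E.-integrable setT g.
  apply: le_integrable int_bound => // x _.
  rewrite [leRHS]gee0_abs; last first.
    by apply: le_trans (convex_bound_ge _ _ s01); rewrite lee_fin.
  by rewrite gee0_abs ?lee_fin//; exact: convex_bound_ge.
have : (\int[alpha \x nu]_x (convex_bound s y \- g) x = 0)%E.
  rewrite integralB// -eq_int subee// eq_int integral_convex_bound//.
  by rewrite fin_numD !fin_numM.
have -> : (\int[alpha \x nu]_x (convex_bound s y \- g) x =
    \int[alpha \x nu]_x `|(convex_bound s y \- g) x|)%E.
  apply: eq_integral => x _; rewrite gee0_abs// sube_ge0//.
  exact: convex_bound_ge.
move/ae_eq_integral_abs => /(_ measurableT).
move=> /(_ (emeasurable_funB (measurable_convex_bound s y) mg)).
apply: filterS => x /= /(_ I) /(congr1 fine) /= /eqP.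
rewrite subr_eq0 => /eqP fE.
have /(congr1 (fun u => (u - x.2) / y)) : y * x.1 + (1 - y) * x.2 = x.2.
  apply: (f_strict s); first by rewrite s0.
  by rewrite fE; congr f; ring.
rewrite subrr mul0r => /eqP; rewrite mulf_eq0 invr_eq0 (negbTE y0) orbF => /eqP h.
have : y * (x.1 - x.2) = 0 by rewrite -h; ring.
by move/eqP; rewrite mulf_eq0 (negbTE y0)/= subr_eq0 => /eqP.
Qed.

End mixture_mean.

(** * The fixed-point equation and an integral bound for the stick-breaking law *)

Section stick_breaking.
Context (d : measure_display) (T : measurableType d) (R : realType).
Context (P : probability T R) (B Y : nat -> {RV P >-> R}).
Context (t : R) (alpha : probability R R).

Let Z (i : nat + nat) : {RV P >-> R} :=
  match i with inl k => B k | inr k => Y k end.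
(** The series restarted at stick [k]: removing a stick turns [S k n.+1] into [S k.+1 n], which is
    independent of that stick. *)
Let S k n w := stick_sum (fun j => Y (j + k)%N w) (fun j => B (j + k)%N w) n.

Context (indZ : mutually_independent Z).
Context (lawB : forall k, same_law (distribution P (B k)) alpha).
Context (lawY : forall k, same_law (distribution P (Y k)) (beta1_law t)).

Let measurable_S_avoiding i0 k n :
  (forall j, (k <= j)%N -> inl j != i0 /\ inr j != i0) ->
  measurable_fun [set: g_sigma_algebraType
    (cylinders_avoiding (fun i => Z i : T -> R) i0)] (S k n).
Proof.
move=> ki0.
apply: (measurable_stick_sum (T := g_sigma_algebraType
  (cylinders_avoiding (fun i => Z i : T -> R) i0))
  (Y := fun j => (Y (j + k)%N : T -> R))
  (B := fun j => (B (j + k)%N : T -> R))) => j.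
  exact: (measurable_avoiding (Z := fun i => Z i : T -> R)
    (ki0 _ (leq_addl _ _)).2).
exact: (measurable_avoiding (Z := fun i => Z i : T -> R)
  (ki0 _ (leq_addl _ _)).1).
Qed.

Let measurable_affine (y b : R) :
  measurable_fun [set: R] (fun s => y * b + (1 - y) * s).
Proof. by apply: measurable_funD => //; exact: measurable_funM. Qed.

Let measurable_S k n : measurable_fun [set: T] (S k n).
Proof.
by apply: (measurable_stick_sum (Y := fun j => (Y (j + k)%N : T -> R))
  (B := fun j => (B (j + k)%N : T -> R))) => j; exact: measurable_funP.
Qed.

Lemma integral_stick_sumS k n (f : R -> \bar R) :
  measurable_fun [set: R] f -> (forall x, 0 <= f x)%E ->
  (\int[P]_w f (S k n.+1 w) =
   \int[distribution P (Y 0%N)]_y \int[alpha]_b \int[P]_w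
     f (y * b + (1 - y) * S k.+1 n w)%R)%E.
Proof.
move=> mf f0.
pose F (x : R * (R * R)) := f (x.1 * x.2.1 + (1 - x.1) * x.2.2).
have mF : measurable_fun setT F.
  apply: (measurableT_comp mf); apply: measurable_funD.
    by apply: measurable_funM => //; exact: measurableT_comp.
  apply: measurable_funM; first exact: measurable_funB.
  exact: measurableT_comp.
have SE w : S k n.+1 w = Y k w * B k w + (1 - Y k w) * S k.+1 n w.
  rewrite /S stick_sumS add0n; congr (_ + _ * stick_sum _ _ _);
    by apply/funext => j; rewrite addSnnS.
transitivity (\int[P]_w F (Z (inr k) w, (Z (inl k) w, S k.+1 n w)))%E.
  by apply: eq_integral => w _; rewrite SE.
(* [S k.+1 n] involves only indices above [k], hence neither [Y k] nor [B k]. *)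
have mS i0 : i0 = inr k \/ i0 = inl k -> measurable_fun
    [set: g_sigma_algebraType (cylinders_avoiding (fun i => Z i : T -> R) i0)]
    (S k.+1 n).
  move=> i0k; apply: measurable_S_avoiding => j kj.
  by case: i0k => ->; split => //; apply/eqP => -[] jk; rewrite jk ltnn in kj.
have mV : measurable_fun
    [set: g_sigma_algebraType (cylinders_avoiding (fun i => Z i : T -> R) (inr k))]
    (fun w => (Z (inl k) w, S k.+1 n w)).
  apply: measurable_fun_pair; last by apply: mS; left.
  exact: (measurable_avoiding (Z := fun i => Z i : T -> R)).
(* Independence is used twice: [Y k] is split from the pair ([B k], [S k.+1 n]), and further down
   [B k] from [S k.+1 n]. *)
rewrite (integral_independent indZ mV mF)//; last by move=> x; exact: f0.
rewrite (eq_measure_integral (distribution P (Y 0%N))); last first.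
  by move=> A mA _; rewrite [LHS]lawY// [RHS]lawY.
apply: eq_integral => y _.
have mFy : measurable_fun setT (fun x => F (y, x)) by exact: measurableT_comp.
rewrite (integral_independent indZ (mS _ (or_intror erefl)) mFy)//; last first.
  by move=> x; exact: f0.
by apply: eq_measure_integral => A mA _; exact: lawB.
Qed.

(** Induction on [n], for all [k] and [f] at once: the affine map s -> y b + (1 - y) s is absorbed
    into the test function, and the recursion sees [k] only through the sum that remains. *)
Lemma integral_stick_sum_shift k n (f : R -> \bar R) :
  measurable_fun [set: R] f -> (forall x, 0 <= f x)%E ->
  (\int[P]_w f (S k n w) = \int[P]_w f (S 0 n w))%E.
Proof.
elim: n k f => [|n IH] k f mf f0.
  by apply: eq_integral => w _; rewrite /S /stick_sum !big_ord0.
rewrite (integral_stick_sumS k n mf f0) (integral_stick_sumS 0 n mf f0).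
apply: eq_integral => y _.
apply: eq_integral => b _.
pose g s := f (y * b + (1 - y) * s).
have mg : measurable_fun setT g by exact: measurableT_comp.
have g0 s : (0 <= g s)%E by exact: f0.
exact: etrans (IH k.+1 g mg g0) (esym (IH 1%N g mg g0)).
Qed.

Lemma integral_stick_sum0S n (f : R -> \bar R) :
  measurable_fun [set: R] f -> (forall x, 0 <= f x)%E ->
  (\int[P]_w f (S 0 n.+1 w) =
   \int[distribution P (Y 0%N)]_y \int[alpha]_b \int[P]_w
     f (y * b + (1 - y) * S 0 n w)%R)%E.
Proof.
move=> mf f0; rewrite (integral_stick_sumS 0 n mf f0); apply: eq_integral => y _.
apply: eq_integral => b _.
pose g s := f (y * b + (1 - y) * s).
have mg : measurable_fun setT g by exact: measurableT_comp.
have g0 s : (0 <= g s)%E by exact: f0.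
exact: (integral_stick_sum_shift 1 n mg g0).
Qed.


Context (X : {RV P >-> R}) (nu : probability R R).
Context (cvgX : {ae P, forall w,
  series (fun k => stick_weight (fun j => Y j w) k * B k w) n
    @[n --> \oo] --> X w}).
Context (lawX : same_law (distribution P X) nu).

Let lawXE (f : R -> \bar R) : measurable_fun [set: R] f ->
  (forall x, 0 <= f x)%E -> (\int[P]_w f (X w) = \int[nu]_x f x)%E.
Proof.
move=> mf f0; rewrite -(ge0_integral_distribution X mf f0).
by apply: eq_measure_integral => A mA _; exact: lawX.
Qed.

Let cvg_S : {ae P, forall w, S 0 n w @[n --> \oo] --> X w}.
Proof.
apply: filterS cvgX => w; apply: cvg_trans; apply: near_eq_cvg.
apply: nearW => n; rewrite /S /stick_sum /series /= big_mkord.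
apply: eq_bigr => j _; rewrite addn0; congr (stick_weight _ _ * _).
by apply/funext => i; rewrite addn0.
Qed.

Let cvg_integral_S (g : R -> R) (M : R) : continuous g ->
  (forall x, 0 <= g x <= M) ->
  (\int[P]_w (g (S 0 n w))%:E)%E @[n --> \oo] --> (\int[nu]_x (g x)%:E)%E.
Proof.
move=> cg gM; have mg := continuous_measurable_fun cg.
rewrite -lawXE; last 2 first.
- exact/measurable_EFinP.
- by move=> x; rewrite lee_fin; case/andP: (gM x).
apply: (@bounded_convergence _ _ _ _ _ _ M) => [n| |n x|].
- by apply/measurable_EFinP; exact: measurableT_comp.
- by apply/measurable_EFinP; exact: measurableT_comp.
- by rewrite !lee_fin.
- apply: filterS cvg_S => w Sw; apply: cvg_EFin; first exact: nearW.
  by apply: continuous_cvg => //; exact: cg.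
Qed.

Let measurable_mix_integral d' (T' : measurableType d') (m : probability T' R)
    (V : T' -> R) (f : R -> R) : measurable_fun [set: T'] V ->
  measurable_fun [set: R] f -> (forall x, 0 <= f x) ->
  measurable_fun [set: R * R]
    (fun z => \int[m]_w (f (z.1 * z.2 + (1 - z.1) * V w))%:E)%E.
Proof.
move=> mV mf f0.
pose F (z : R * R * T') := (f (z.1.1 * z.1.2 + (1 - z.1.1) * V z.2))%:E.
have mF : measurable_fun setT F.
  apply/measurable_EFinP; apply: (measurableT_comp mf).
  apply: measurable_funD; first by apply: measurable_funM; exact: measurableT_comp.
  apply: measurable_funM; last exact: measurableT_comp.
  by apply: measurable_funB => //; exact: measurableT_comp.
have F0 z : (0 <= F z)%E by rewrite lee_fin.
exact: (measurable_fun_fubini_tonelli_F (m2 := m) F mF F0).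
Qed.

(** The limit of [integral_stick_sum0S] as n grows. The inner integral converges for fixed y and b
    by [cvg_integral_S], and bounded convergence passes this through the integral over the law of
    (Y_1, B_1). *)
Let integral_bounded_mixture (g : R -> R) (M : R) : continuous g ->
  (forall x, 0 <= g x <= M) ->
  (\int[nu]_x (g x)%:E =
   \int[distribution P (Y 0%N)]_y mixture_mean g alpha nu y)%E.
Proof.
move=> cg gM; have mg := continuous_measurable_fun cg.
have g0 x : 0 <= g x by case/andP: (gM x).
pose muYB : probability (R * R)%type R := (distribution P (Y 0%N) \x alpha)%E.
pose h n (z : R * R) := (\int[P]_w (g (z.1 * z.2 + (1 - z.1) * S 0 n w))%:E)%E.
pose h' (z : R * R) := (\int[nu]_x (g (z.1 * z.2 + (1 - z.1) * x))%:E)%E.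
have mh n : measurable_fun setT (h n) by exact: measurable_mix_integral.
have mh' : measurable_fun setT h' by exact: measurable_mix_integral.
have h0 n z : (0 <= h n z)%E by apply: integral_ge0 => w _; rewrite lee_fin.
have h'0 z : (0 <= h' z)%E by apply: integral_ge0 => w _; rewrite lee_fin.
have SnE n : (\int[P]_w (g (S 0 n.+1 w))%:E = \int[muYB]_z h n z)%E.
  have mEg : measurable_fun [set: R] (EFin \o g) by exact/measurable_EFinP.
  have g0E x : (0 <= (EFin \o g) x)%E by rewrite lee_fin.
  by rewrite (integral_stick_sum0S n mEg g0E) fubini_tonelli1.
have lim1 : (\int[muYB]_z h n z)%E @[n --> \oo] --> (\int[nu]_x (g x)%:E)%E.
  under eq_fun do rewrite -SnE.
  have := cvg_integral_S cg gM.
  by rewrite -(cvg_shiftS (fun n => \int[P]_w (g (S 0 n w))%:E)%E).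
have lim2 : (\int[muYB]_z h n z)%E @[n --> \oo] --> (\int[muYB]_z h' z)%E.
  apply: (@bounded_convergence _ _ _ _ _ _ M) => // [n z|].
    rewrite h0/=; apply: (@le_trans _ _ (\int[P]_w (cst M%:E w))%E).
      apply: ge0_le_integral => //.
      + by move=> w _; rewrite lee_fin.
      + apply/measurable_EFinP; apply: (measurableT_comp mg).
        by apply: measurable_funD => //; exact: measurable_funM.
      + move=> w _; rewrite lee_fin.
        by case/andP: (gM (z.1 * z.2 + (1 - z.1) * S 0 n w)).
    by rewrite integral_cst//= probability_setT mule1.
  apply/aeW => z; apply: (cvg_integral_S (M := M)) => // x.
  apply: continuous_comp; last exact: cg.
  by apply: cvgD; [exact: cvg_cst|apply: cvgMr; exact: cvg_id].
rewrite (cvg_unique _ lim1 lim2)//= fubini_tonelli1//.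
by apply: eq_integral => y _; rewrite mixture_meanE.
Qed.

(** Bounded continuous functions increasing to [f], used to pass from bounded to unbounded test
    functions. *)
Let truncate (f : R -> R) (n : nat) (x : R) : R := Num.min (f x) n%:R.

Let truncate_bound f n x : (forall x, 0 <= f x) -> 0 <= truncate f n x <= n%:R.
Proof. by move=> f0; rewrite /truncate le_min f0 ler0n ge_min lexx orbT. Qed.

Let continuous_truncate f n : continuous f -> continuous (truncate f n).
Proof. by move=> cf; apply: (min_fun_continuous cf) => x; exact: cvg_cst. Qed.

Let truncate_nd f x :
  {homo (fun n => (truncate f n x)%:E) : n k / (n <= k)%N >-> (n <= k)%E}.
Proof.
move=> n k nk; rewrite lee_fin /truncate le_min !ge_min lexx/=.
by rewrite ler_nat nk orbT.
Qed.

Let truncate_cvg f x : (truncate f n x)%:E @[n --> \oo] --> (f x)%:E.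
Proof.
apply: cvg_near_cst; near=> n; congr EFin; rewrite /truncate; apply/min_idPl.
by near: n; exact: nbhs_infty_ger.
Unshelve. all: by end_near. Qed.

Let truncate_integral d' (T' : measurableType d') (m : {measure set T' -> \bar R})
    (f : R -> R) (V : T' -> R) :
  measurable_fun [set: T'] V -> continuous f -> (forall x, 0 <= f x) ->
  (\int[m]_w (truncate f n (V w))%:E)%E @[n --> \oo] -->
  (\int[m]_w (f (V w))%:E)%E.
Proof.
move=> mV cf f0; apply: monotone_cvg_integral => //.
- move=> n; apply/measurable_EFinP; apply: measurableT_comp => //.
  exact: (continuous_measurable_fun (@continuous_truncate f n cf)).
- by move=> n w; rewrite lee_fin; case/andP: (truncate_bound n (V w) f0).
Qed.

(** The identity in law X = Y_1 B_1 + (1 - Y_1) X', obtained by monotone convergence along the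
    truncations; both sides may be infinite. *)
Lemma integral_mixture (f : R -> R) : continuous f -> (forall x, 0 <= f x) ->
  (\int[nu]_x (f x)%:E =
   \int[distribution P (Y 0%N)]_y mixture_mean f alpha nu y)%E.
Proof.
move=> cf f0.
have lim1 := truncate_integral (m := nu) (@measurable_id _ R setT) cf f0.
have lim2 : (\int[distribution P (Y 0%N)]_y mixture_mean (truncate f n) alpha nu y)%E
    @[n --> \oo] -->
    (\int[distribution P (Y 0%N)]_y mixture_mean f alpha nu y)%E.
  have tf0 n x : 0 <= truncate f n x by case/andP: (truncate_bound n x f0).
  have mtf n : measurable_fun [set: R] (truncate f n).
    exact: (continuous_measurable_fun (@continuous_truncate f n cf)).
  apply: monotone_cvg_integral => [n|n y|y n k nk|y].
  - exact: measurable_mixture_mean.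
  - exact: mixture_mean_ge0.
  - apply: ge0_le_integral => //.
    + by move=> x _; rewrite lee_fin.
    + exact: measurable_mix.
    + exact: measurable_mix.
    + by move=> x _; exact: truncate_nd.
  - apply: (truncate_integral (V := fun x : R * R => y * x.1 + (1 - y) * x.2)) => //.
    by apply: measurable_funD; apply: measurable_funM.
have E : (fun n => \int[nu]_x (truncate f n x)%:E)%E =
    (fun n => \int[distribution P (Y 0%N)]_y
       mixture_mean (truncate f n) alpha nu y)%E.
  apply/funext => n; apply: integral_bounded_mixture.
    exact: continuous_truncate.
  by move=> x; exact: truncate_bound.
by move: lim1; rewrite E => lim1; exact: (cvg_unique _ lim1 lim2).
Qed.

Let Y01 : {ae distribution P (Y 0%N), forall y, 0 <= y <= 1}.
Proof.
exists (~` `]0, 1[%classic); split; first exact: measurableC.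
  rewrite lawY; last exact: measurableC.
  by rewrite /beta1_law setICl integral_set0.
move=> y /= yN y01; apply: yN; move: y01; rewrite in_itv/= => /andP[y0 y1].
by rewrite !ltW.
Qed.

Context (f : R -> R).
Context (cf : continuous f) (f0 : forall x, 0 <= f x).
Context (f_min : forall x, f 0 <= f x).
Context (f_convex : forall s x z, 0 <= s <= 1 ->
  f (s * x + (1 - s) * z) <= s * f x + (1 - s) * f z).

(** Induction on [n]. The empty sum is 0, where [f] is least. One more stick mixes [alpha] with the
    law of [S 0 n], and convexity bounds the result by y A + (1 - y) A = A. *)
Let integral_S_le n :
  (\int[P]_w (f (S 0 n w))%:E <= \int[alpha]_x (f x)%:E)%E.
Proof.
have mf := continuous_measurable_fun cf.
have mEf : measurable_fun [set: R] (EFin \o f) by exact/measurable_EFinP.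
have f0E x : (0 <= (EFin \o f) x)%E by rewrite lee_fin.
elim: n => [|n IH].
  rewrite [leLHS](_ : _ = (f 0)%:E); last first.
    under eq_integral do rewrite /S /stick_sum big_ord0.
    by rewrite integral_cst//= probability_setT mule1.
  rewrite [leLHS](_ : _ = \int[alpha]_x (cst (f 0)%:E x))%E; last first.
    by rewrite integral_cst//= probability_setT mule1.
  by apply: ge0_le_integral => // x _; rewrite lee_fin.
rewrite (integral_stick_sum0S n mEf f0E).
set A := (\int[alpha]_x (f x)%:E)%E in IH *.
pose Sn : {mfun T >-> R} := HB.pack (S 0 n)
  (isMeasurableFun.Build _ _ _ _ _ (measurable_S 0 n)).
pose nun : probability R R := distribution P Sn.
have mixE y : (\int[alpha]_b \int[P]_w (EFin \o f) (y * b + (1 - y) * S 0 n w)%R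
    = mixture_mean f alpha nun y)%E.
  rewrite mixture_meanE//; apply: eq_integral => b _.
  rewrite ge0_integral_distribution// => [|s]; last by rewrite lee_fin.
  by apply/measurable_EFinP; exact: measurableT_comp.
have mix0 : (mixture_mean f alpha nun 0 <= A)%E.
  by rewrite mixture_mean0// ge0_integral_distribution.
have mix_le y : 0 <= y <= 1 -> (mixture_mean f alpha nun y <= A)%E.
  move=> /[dup] /andP[y0 y1] y01.
  have := mixture_mean_convex alpha nun mf f0 f_convex 1 y01.
  rewrite mulr1 mixture_mean1// -/A => /le_trans; apply.
  (* [A] may be infinite; distributivity still holds since both weights are nonnegative. *)
  have AE : A = (y%:E * A + (1 - y)%:E * A)%E.
    by rewrite -ge0_muleDl ?lee_fin ?subr_ge0// -EFinD addrC subrK mul1e.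
  by rewrite [leRHS]AE leeD2l// lee_wpmul2l// lee_fin subr_ge0.
rewrite (eq_integral (mixture_mean f alpha nun)); last by move=> y _; exact: mixE.
have A0 : (0 <= A)%E by apply: integral_ge0 => x _; rewrite lee_fin.
rewrite [leRHS](_ : _ = \int[distribution P (Y 0%N)]_y cst A y)%E; last first.
  by rewrite integral_cst//= probability_setT mule1.
apply: ae_ge0_le_integral => //.
- by move=> y _; exact: mixture_mean_ge0.
- exact: measurable_mixture_mean.
- by apply: filterS Y01 => y y01 _; exact: mix_le.
Qed.

(** Carries integrability from [alpha] over to [nu], as needed for D to be finite. As in Fatou's
    lemma, the number of sticks tends to infinity at a fixed truncation level, and only then is the
    level raised. *)
Lemma integral_stick_breaking_le :
  (\int[nu]_x (f x)%:E <= \int[alpha]_x (f x)%:E)%E.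
Proof.
have lim1 := truncate_integral (m := nu) (@measurable_id _ R setT) cf f0.
apply: (cvge_to_le lim1); apply: nearW => n /=.
have lim2 := cvg_integral_S (@continuous_truncate f n cf)
  (fun x => truncate_bound n x f0).
suff : (\int[nu]_x (truncate f n x)%:E <= \int[alpha]_x (f x)%:E)%E by [].
apply: (cvge_to_le lim2).
apply: nearW => k; apply: le_trans (integral_S_le k).
have mf := continuous_measurable_fun cf.
apply: ge0_le_integral => //.
- by move=> w _; rewrite lee_fin; case/andP: (truncate_bound n (S 0 k w) f0).
- apply/measurable_EFinP; apply: measurableT_comp => //.
  exact: (continuous_measurable_fun (@continuous_truncate f n cf)).
- by apply/measurable_EFinP; exact: measurableT_comp.
- by move=> w _; rewrite lee_fin /truncate ge_min lexx.
Qed.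

End stick_breaking.

Lemma stick_breaking_law_mixture (R : realType) (t : R)
    (alpha nu : probability R R) (f : R -> R) :
  0 < t -> stick_breaking_law t alpha nu ->
  continuous f -> (forall x, 0 <= f x) ->
  (\int[nu]_x (f x)%:E =
   \int[lebesgue_measure]_(y in `]0%R, 1%R[)
     (mixture_mean f alpha nu y * (beta1_density t y)%:E))%E.
Proof.
move=> t0 [d [T [P [B [Y [X [indZ lawB lawY cvgX lawX]]]]]]] cf f0.
have mf := continuous_measurable_fun cf.
rewrite (integral_mixture indZ lawB lawY cvgX lawX cf f0).
apply: (integral_beta1_law t0 (lawY 0%N)); first exact: measurable_mixture_mean.
by move=> y; exact: mixture_mean_ge0.
Qed.

Lemma stick_breaking_law_le (R : realType) (t : R)
    (alpha nu : probability R R) (f : R -> R) :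
  stick_breaking_law t alpha nu ->
  continuous f -> (forall x, 0 <= f x) -> (forall x, f 0 <= f x) ->
  (forall s x z, 0 <= s <= 1 ->
    f (s * x + (1 - s) * z) <= s * f x + (1 - s) * f z) ->
  (\int[nu]_x (f x)%:E <= \int[alpha]_x (f x)%:E)%E.
Proof.
move=> [d [T [P [B [Y [X [indZ lawB lawY cvgX lawX]]]]]]] cf f0 f_min f_convex.
exact: (integral_stick_breaking_le indZ lawB lawY cvgX lawX).
Qed.

(** No antiderivative is computed: the integral is the total mass of the law of [Y 0]. *)
Lemma integral_beta1_density (R : realType) (t : R)
    (alpha nu : probability R R) : 0 < t -> stick_breaking_law t alpha nu ->
  (\int[lebesgue_measure]_(y in `]0%R, 1%R[) (beta1_density t y)%:E = 1)%E.
Proof.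
move=> t0 [d [T [P [B [Y [X [_ _ lawY _ _]]]]]]].
have := lawY 0%N setT measurableT; rewrite probability_setT => ->.
by rewrite /beta1_law setTI.
Qed.

(** * Almost everywhere arguments and changes of sign *)

Lemma ae_exists (d : measure_display) (T : measurableType d) (R : realType)
    (m : {measure set T -> \bar R}) (A : set T) (Q : T -> Prop) :
  measurable A -> (0 < m A)%E -> {ae m, forall x, Q x} ->
  exists2 x, A x & Q x.
Proof.
move=> mA A0 [N [mN N0 QN]]; apply: contrapT => AQ.
suff : (m A <= m N)%E by rewrite N0 leNgt A0.
apply: le_measure; rewrite ?inE// => x Ax; apply: QN => Qx.
by apply: AQ; exists x.
Qed.

(** By Tonelli, for [nu]-almost every a the section at a of the exceptional null set is
    [alpha]-null. It contains every x other than a, so a single such a carries all the mass of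
    [alpha]. *)
Lemma ae_diagonal_dirac (R : realType) (alpha nu : probability R R) :
  {ae (alpha \x nu)%E, forall x, x.1 = x.2} ->
  exists a : R, same_law alpha (dirac a).
Proof.
move=> [N [mN N0 diagN]].
pose i (x : R * R) : \bar R := (\1_N x)%:E.
have mi : measurable_fun setT i.
  by apply/measurable_EFinP; exact: measurable_indic.
have i0 x : (0 <= i x)%E by rewrite lee_fin.
have : (\int[alpha \x nu]_x i x = 0)%E by rewrite integral_indic// setIT.
rewrite fubini_tonelli2// => int0.
have mG := measurable_fun_fubini_tonelli_G (m1 := alpha) i mi i0.
have : ae_eq nu setT (fubini_G alpha i) (cst 0%E).
  apply/ae_eq_integral_abs => //; rewrite -[RHS]int0; apply: eq_integral => x _.
  by rewrite gee0_abs// integral_ge0.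
have nu0 : (0 < nu [set: R])%E by rewrite probability_setT.
move=> /(ae_exists measurableT nu0)[a _ /(_ I)].
rewrite /fubini_G /i => alpha0; exists a => A mA.
have mNa : measurable (ysection N a) by exact: measurable_ysection.
have alphaN : alpha (ysection N a) = 0%E.
  rewrite -[RHS]alpha0 -[LHS]mule1 -[in LHS](setIT (ysection N a)).
  rewrite mule1 -integral_indic//; apply: eq_integral => x _.
  by rewrite !indicE mem_ysection.
have null C : measurable C -> ~ C a -> alpha C = 0%E.
  move=> mC Ca; apply/eqP; rewrite eq_le measure_ge0 andbT -[leRHS]alphaN.
  apply: le_measure; rewrite ?inE// => x Cx; rewrite /ysection/= inE.
  by apply: diagN => /= xa; apply: Ca; rewrite -xa.
rewrite diracE; have [aA|/negP aA] := boolP (a \in A).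
  have := null (~` A) (measurableC mA); rewrite probability_setC//.
  move=> /(_ (fun h => h (set_mem aA))) /eqP.
  by rewrite sube_eq ?add0e// => /eqP <-.
by rewrite null// => Aa; apply: aA; exact: mem_set.
Qed.

(* The hypothesis is the convexity of D between 0, u and v when D 0 = 0. *)
Lemma sign_change (R : realType) (D : R -> R) :
  (forall u v, 0 < u -> u < v -> v < 1 -> D u <= u / v * D v) ->
  exists2 y0, 0 <= y0 <= 1 &
    forall y, 0 < y < 1 -> (y < y0 -> D y <= 0) /\ (y0 < y -> 0 <= D y).
Proof.
move=> Dconv; pose E := [set y | 0 < y < 1 /\ 0 < D y].
have [E0|/set0P[e [/andP[e0 e1] De]]] := eqVneq E set0.
  exists 1; first by rewrite ler01 lexx.
  move=> y /[dup] y01 /andP[y0 y1]; split; last by rewrite ltNge ltW.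
  move=> _; rewrite leNgt; apply/negP => Dy.
  by have : set0 y by rewrite -E0.
have lbE : lbound E 0 by move=> y [/andP[/ltW]].
have hiE : has_inf E by split; [exists e; split; rewrite ?e0|exists 0].
(* Below the infimum D is nowhere positive. Above it, some z < y has D z > 0, and the hypothesis
   then makes D y positive. *)
exists (inf E).
  rewrite lb_le_inf//=; last by exists e; split; rewrite ?e0.
  by apply: le_trans (ltW e1); apply: ge_inf; [exists 0|split; rewrite ?e0].
move=> y /[dup] y01 /andP[y0 y1]; split => [yE|Ey].
  rewrite leNgt; apply/negP => Dy.
  have : inf E <= y by apply: ge_inf; [exists 0|split].
  by rewrite leNgt yE.
have [z [/andP[z0 z1] Dz] zy] := inf_lt hiE.1 Ey.
have := Dconv z y z0 zy y1; move/(lt_le_trans Dz).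
by rewrite pmulr_rgt0 ?divr_gt0// => /ltW.
Qed.

(** Both D and the difference of powers pass from nonpositive to nonnegative at y0, so G >= 0 and
    its zero integral gives G = 0 almost everywhere. The powers differ away from y0, so D vanishes
    almost everywhere, in particular somewhere in ]u, v[. *)
Lemma weighted_zero (R : realType) (D : R -> R) (b c y0 : R) :
  b < c -> 0 <= y0 <= 1 ->
  (forall y, 0 < y < 1 -> (y < y0 -> D y <= 0) /\ (y0 < y -> 0 <= D y)) ->
  let G y := D y * ((1 - y) `^ (b - 1) *
                    ((1 - y0) `^ (c - b) - (1 - y) `^ (c - b))) in
  measurable_fun [set: R] G ->
  (\int[lebesgue_measure]_(y in `]0%R, 1%R[) (G y)%:E = 0)%E ->
  forall u v, 0 <= u -> u < v -> v <= 1 -> exists2 y, u < y < v & D y = 0.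
Proof.
move=> bc /andP[y00 y01] Dsign G mG intG u v u0 uv v1.
pose mu : {measure set (measurableTypeR R) -> \bar R} := @lebesgue_measure R.
have cb0 : 0 < c - b by rewrite subr_gt0.
have pow_lt x z : 0 <= x -> x < z -> x `^ (c - b) < z `^ (c - b).
  by move=> x0 xz; apply: gt0_ltr_powR; rewrite ?nnegrE// ltW// (le_lt_trans x0).
have G0 y : 0 < y < 1 -> 0 <= G y.
  move=> /[dup] yI /andP[yp y1]; have [Dneg Dpos] := Dsign y yI; rewrite /G.
  have [yy0|yy0|->] := ltgtP y y0; last by rewrite subrr !mulr0.
  - rewrite mulr_le0// ?Dneg// mulr_ge0_le0 ?powR_ge0// subr_le0 ltW//.
    by apply: pow_lt; lra.
  - rewrite !mulr_ge0 ?Dpos ?powR_ge0// subr_ge0 ltW//.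
    by apply: pow_lt; lra.
have : ae_eq mu `]0%R, 1%R[%classic (EFin \o G) (cst 0%E).
  apply/ae_eq_integral_abs => //.
    by apply: measurable_funTS; exact/measurable_EFinP.
  rewrite -[RHS]intG; apply: eq_integral => y; rewrite inE/= in_itv/= => yI.
  by rewrite ger0_norm// G0.
(* At y0 itself G vanishes whatever D is; this point is negligible. *)
have : {ae mu, forall y, y != y0}.
  exists [set y0]; split => //; first exact: lebesgue_measure_set1.
  by move=> y /= /negP; rewrite negbK => /eqP.
move=> ny0 G0ae.
have ae_D : {ae mu, forall y, 0 < y < 1 -> D y = 0}.
  apply: (@filterS2 _ _ (ae_filter_ringOfSetsType mu) _ _ _ _ ny0 G0ae).
  move=> y yy0 /= Gy /[dup] yI /andP[yp y1].
  have yI' : y \in `]0, 1[ by rewrite in_itv.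
  have /(congr1 fine) /= /eqP := Gy yI'.
  rewrite !mulf_eq0 => /orP[/eqP//|/orP[|]].
    by rewrite powR_eq0 subr_eq0 eq_sym (lt_eqF y1).
  rewrite subr_eq0; have [h|h|h] := ltgtP y y0; last by rewrite h eqxx in yy0.
    by rewrite lt_eqF// pow_lt//; lra.
  by rewrite gt_eqF// pow_lt//; lra.
have uv0 : (0 < mu `]u, v[%classic)%E.
  by rewrite [mu _]lebesgue_measure_itv/= lte_fin uv -EFinD lte_fin subr_gt0.
have [|y] := ae_exists _ uv0 ae_D; first exact: measurable_itv.
rewrite /= in_itv/= => /andP[uy yv] Dy; exists y; first by rewrite uy.
by apply: Dy; rewrite (le_lt_trans u0)//= (lt_le_trans yv).
Qed.

Lemma same_law_trans (R : realType) (m1 m2 m3 : set R -> \bar R) :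
  same_law m1 m2 -> same_law m2 m3 -> same_law m1 m3.
Proof. by move=> m12 m23 A mA; rewrite m12// m23. Qed.

Lemma is_mu_same_law (R : realType) (t : R) (alpha nu nu' : probability R R) :
  same_law nu nu' -> is_mu t alpha nu -> is_mu t alpha nu'.
Proof.
move=> nunu' [[t0 nu_alpha]|[t0 [d [T [P [B [Y [X [? ? ? ? lawX]]]]]]]]].
  by left; split=> // A mA; rewrite -nunu'// nu_alpha.
right; split => //; exists d, T, P, B, Y, X; split => //.
exact: same_law_trans nunu'.
Qed.

(** * The function D for the bracket *)

Section defect.
Context (R : realType) (alpha nu : probability R R).
Context (bracket_alpha : (\int[alpha]_x (bracket x)%:E < +oo)%E).
Context (bracket_nu : (\int[nu]_x (bracket x)%:E < +oo)%E).

Let bracket_ge0 (x : R) : 0 <= bracket x.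
Proof. exact: le_trans (bracket_ge1 x). Qed.

Let measurable_bracket : measurable_fun [set: R] (@bracket R).
Proof. by apply: continuous_measurable_fun; exact: continuous_bracket. Qed.

Let h := mixture_mean (@bracket R) alpha nu.

Let h0_fin : h 0 \is a fin_num.
Proof.
by rewrite ge0_fin_numE ?mixture_mean_ge0// /h mixture_mean0.
Qed.

(** Convexity gives h(y) <= y h(1) + (1 - y) h(0), where h(1) and h(0) are the integrals of the
    bracket under [alpha] and [nu]. *)
Let h_fin y : 0 <= y <= 1 -> h y \is a fin_num.
Proof.
move=> y01; rewrite ge0_fin_numE; last exact: mixture_mean_ge0.
have := mixture_mean_convex alpha nu measurable_bracket bracket_ge0
  (@bracket_convex R) 1 y01.
rewrite mulr1 => /le_lt_trans; apply.
rewrite lte_add_pinfty// lte_mul_pinfty//.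
- by rewrite lee_fin; case/andP: y01.
- by rewrite mixture_mean1.
- by rewrite lee_fin subr_ge0; case/andP: y01.
- by rewrite mixture_mean0.
Qed.

(* The function D of the introductory comment, for f = [bracket]. *)
Definition defect (y : R) : R :=
  fine (mixture_mean (@bracket R) alpha nu y) -
  fine (mixture_mean (@bracket R) alpha nu 0).

Lemma measurable_defect : measurable_fun [set: R] defect.
Proof.
apply: measurable_funB => //; apply: measurableT_comp => //.
exact: measurable_mixture_mean.
Qed.

Lemma defect_convex u v : 0 < u -> u < v -> v <= 1 ->
  defect u <= u / v * defect v.
Proof.
move=> u0 uv v1; have v0 := lt_trans u0 uv.
have s01 : 0 <= u / v <= 1.
  by rewrite ler_pdivrMr// mul1r (ltW uv) divr_ge0// ltW.
have := mixture_mean_convex alpha nu measurable_bracket bracket_ge0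
  (@bracket_convex R) v s01.
rewrite -/h divfK ?gt_eqF// -(fineK h0_fin).
rewrite -(fineK (h_fin (y := u) _)); last by rewrite ltW//= ltW// (lt_le_trans uv).
rewrite -(fineK (h_fin (y := v) _)); last by rewrite ltW.
rewrite -!EFinM -EFinD lee_fin /defect -/h; lra.
Qed.

(** The two zeros give h(u) = h(v) = h(0), which is equality in the convexity inequality at u = (u /
    v) v, so [mixture_mean_strict] applies. *)
Lemma defect_eq0 u v : 0 < u -> u < v -> v <= 1 ->
  defect u = 0 -> defect v = 0 -> exists a : R, same_law alpha (dirac a).
Proof.
move=> u0 uv v1 /subr0_eq Du /subr0_eq Dv; have v0 := lt_trans u0 uv.
have s01 : 0 < u / v < 1 by rewrite divr_gt0//= ltr_pdivrMr// mul1r.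
apply: (@ae_diagonal_dirac _ alpha nu).
apply: (mixture_mean_strict measurable_bracket bracket_ge0 (@bracket_convex R)
  (@bracket_strict R) s01 (y := v)); rewrite -/h ?gt_eqF//.
  by apply: h_fin; rewrite v1 ltW.
rewrite divfK ?gt_eqF//.
rewrite -(fineK (h_fin (y := u) _)); last by rewrite ltW//= ltW// (lt_le_trans uv).
rewrite -(fineK (h_fin (y := v) _)); last by rewrite ltW.
rewrite /h Du Dv -/h -(fineK h0_fin) -!EFinM -EFinD; congr EFin => /=; lra.
Qed.

Let mu : {measure set (measurableTypeR R) -> \bar R} := @lebesgue_measure R.

(** The fixed-point equation says that h integrates to h(0) against the beta density, whose mass is
    1. Integrability is recorded too, because D is signed and these integrals are later combined
    linearly. *)
Lemma defect_integral (t : R) : 0 < t -> stick_breaking_law t alpha nu ->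
  mu.-integrable `]0%R, 1%R[%classic
    (EFin \o (fun y => defect y * (1 - y) `^ (t - 1))) /\
  (\int[mu]_(y in `]0%R, 1%R[) (defect y * (1 - y) `^ (t - 1))%:E = 0)%E.
Proof.
move=> t0 st.
pose w := @beta1_density R t.
pose I01 : set (measurableTypeR R) := `]0%R, 1%R[%classic.
have mw : measurable_fun I01 (EFin \o w).
  apply/measurable_EFinP/measurable_funTS; exact: measurable_beta1_density.
have w0 y : 0 <= w y by rewrite mulr_ge0 ?powR_ge0// ltW.
have intw : (\int[mu]_(y in `]0%R, 1%R[) (w y)%:E = 1)%E.
  exact: integral_beta1_density t0 st.
pose k y := fine (h y) * w y.
have mk : measurable_fun I01 (EFin \o k).
  apply/measurable_EFinP/measurable_funTS/measurable_funM.
    by apply: measurableT_comp => //; exact: measurable_mixture_mean.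
  exact: measurable_beta1_density.
have k0 y : 0 <= k y by rewrite mulr_ge0// fine_ge0// mixture_mean_ge0.
have intk : (\int[mu]_(y in `]0%R, 1%R[) (k y)%:E = h 0)%E.
  rewrite /h mixture_mean0//.
  rewrite (stick_breaking_law_mixture t0 st (@continuous_bracket R))//.
  apply: eq_integral => y; rewrite inE/= in_itv/= => /andP[y0 y1].
  by rewrite /k EFinM fineK// h_fin// !ltW.
have ge0_integrable (g : R -> R) : measurable_fun I01 (EFin \o g) ->
    (forall y, 0 <= g y) ->
    (\int[mu]_(y in `]0%R, 1%R[) (g y)%:E < +oo)%E ->
    mu.-integrable `]0%R, 1%R[%classic (EFin \o g).
  move=> mg g0 g_fin; apply/integrableP; split => //.
  by under eq_integral do rewrite gee0_abs ?lee_fin//.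
have iw : mu.-integrable `]0%R, 1%R[%classic (EFin \o w).
  by apply: ge0_integrable => //; rewrite intw ltry.
have ik : mu.-integrable `]0%R, 1%R[%classic (EFin \o k).
  by apply: ge0_integrable => //; rewrite intk -ge0_fin_numE// mixture_mean_ge0.
have ikw : mu.-integrable `]0%R, 1%R[%classic
    (fun y => (t^-1)%:E * ((EFin \o k) y - (fine (h 0))%:E * (EFin \o w) y))%E.
  by apply: integrableZl => //; apply: integrableB => //; apply: integrableZl.
(* The factor t^-1 cancels the constant t of [beta1_density]. *)
have E y : (defect y * (1 - y) `^ (t - 1))%:E =
    ((t^-1)%:E * ((EFin \o k) y - (fine (h 0))%:E * (EFin \o w) y))%E.
  transitivity (t^-1 * (k y - fine (h 0) * w y))%:E; last by [].
  congr EFin.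
  rewrite /k /w /beta1_density /defect -/h; field.
  by rewrite gt_eqF.
split.
  by apply: eq_integrable ikw => // y _; rewrite -E.
under eq_integral do rewrite E.
rewrite integralZl//; last by apply: integrableB => //; apply: integrableZl.
rewrite integralB//; last exact: integrableZl.
by rewrite integralZl// intk intw mule1 fineK// subee// mule0.
Qed.

End defect.

(** * Comparison of the two parameters *)

Theorem corollary6p5 (R : realType) (alpha : probability R R)
  (alpha_mean : (\int[alpha]_x `|x|%:E < +oo)%E)
  (b c : R) (b_ge0 : 0 <= b) (b_lt_c : b < c)
  (nu_b nu_c : probability R R)
  (mu_b : is_mu b alpha nu_b) (mu_c : is_mu c alpha nu_c)
  (mu_b_eq_mu_c : same_law nu_b nu_c) :
  exists a : R, same_law alpha (dirac a).
Proof.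
have {mu_b} := is_mu_same_law mu_b_eq_mu_c mu_b.
move: nu_c mu_c {nu_b mu_b_eq_mu_c} => nu mu_c mu_b.
have c0 : 0 < c by exact: le_lt_trans b_lt_c.
have {mu_c} st_c : stick_breaking_law c alpha nu.
  by case: mu_c => [[c00]|[]//]; rewrite c00 ltxx in c0.
have bracket_ge0 (x : R) : 0 <= bracket x by exact: le_trans (bracket_ge1 x).
have mb : measurable_fun [set: R] (@bracket R).
  by apply: continuous_measurable_fun; exact: continuous_bracket.
have mbracket : measurable_fun [set: R] (EFin \o @bracket R).
  exact/measurable_EFinP.
(* The finite mean of [alpha] enters here, through [bracket_le]. *)
have fin_alpha : (\int[alpha]_x (bracket x)%:E < +oo)%E.
  have mnorm : measurable_fun [set: R] (fun x : R => `|x|%:E).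
    by apply/measurable_EFinP; exact: normr_measurable.
  have : (\int[alpha]_x (cst 1 x + `|x|%:E) < +oo)%E.
    rewrite ge0_integralD//= integral_cst//= probability_setT mule1.
    by rewrite lte_add_pinfty// ltry.
  have m1norm := emeasurable_funD (measurable_cst 1%E) mnorm.
  apply: le_lt_trans; apply: (ge0_le_integral _ _ _ mbracket m1norm) => //= x _.
    by rewrite lee_fin.
  by rewrite -EFinD lee_fin bracket_le.
have fin_nu : (\int[nu]_x (bracket x)%:E < +oo)%E.
  apply: le_lt_trans fin_alpha; apply: (stick_breaking_law_le st_c) => //.
  - exact: continuous_bracket.
  - by move=> x; rewrite {1}/bracket expr0n addr0 sqrtr1 bracket_ge1.
  - exact: bracket_convex.
pose D := defect alpha nu.
have [int_c int_c0] := defect_integral fin_alpha fin_nu c0 st_c.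
pose G y0 y := D y * ((1 - y) `^ (b - 1) *
  ((1 - y0) `^ (c - b) - (1 - y) `^ (c - b))).
have mG y0 : measurable_fun [set: R] (G y0).
  have mpow r : measurable_fun [set: R] (fun y => (1 - y) `^ r).
    apply: (@measurableT_comp _ _ _ _ _ _ (@powR R ^~ r)).
      exact: measurable_powR.
    exact: measurable_funB.
  apply: measurable_funM; first exact: measurable_defect.
  by apply: measurable_funM => //; exact: measurable_funB.
(* G combines the integrands of [defect_integral] at b and at c, so its integral vanishes when both
   of theirs do. *)
have GE y0 y : 0 < y < 1 -> G y0 y =
    (1 - y0) `^ (c - b) * (D y * (1 - y) `^ (b - 1)) - D y * (1 - y) `^ (c - 1).
  move=> /andP[_ y1].
  have -> : (1 - y) `^ (c - 1) = (1 - y) `^ (b - 1) * (1 - y) `^ (c - b).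
    rewrite -powRD; first by congr (_ `^ _); ring.
    by apply/implyP => _; rewrite subr_eq0 gt_eqF.
  by rewrite /G; ring.
have [y0 y01 Dsign] : exists2 y0, 0 <= y0 <= 1 &
    (forall y, 0 < y < 1 -> (y < y0 -> D y <= 0) /\ (y0 < y -> 0 <= D y)) /\
    (\int[lebesgue_measure]_(y in `]0%R, 1%R[) (G y0 y)%:E = 0)%E.
  have intE y0 : (\int[lebesgue_measure]_(y in `]0%R, 1%R[) (G y0 y)%:E =
      \int[lebesgue_measure]_(y in `]0%R, 1%R[)
        (((1 - y0) `^ (c - b))%:E * (D y * (1 - y) `^ (b - 1))%:E
          - (D y * (1 - y) `^ (c - 1))%:E))%E.
    by apply: eq_integral => y; rewrite inE/= in_itv/= => /GE ->.
  case: mu_b => [[b0 nu_alpha]|[b_gt0 st_b]].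
    (* For b = 0, [nu] agrees with [alpha], so D(1) = 0 and convexity makes D nonpositive on all of
       ]0, 1[. *)
    exists 1; first by rewrite ler01 lexx.
    split.
      move=> y /andP[yp y1]; split; last by rewrite ltNge ltW.
      move=> _; have := defect_convex fin_alpha fin_nu yp y1 (lexx 1).
      have -> : defect alpha nu 1 = 0.
        rewrite /defect mixture_mean0// mixture_mean1//; apply/eqP.
        rewrite subr_eq0; apply/eqP; congr fine; apply: eq_measure_integral.
        by move=> A mA _; exact: esym (nu_alpha A mA).
      by rewrite mulr0.
    (* With y0 = 1 the coefficient 0^(c - b) is 0. It removes the term with exponent b - 1 = -1, to
       which [defect_integral] does not apply. *)
    rewrite intE subrr powR0 ?gt_eqF ?subr_gt0//.
    under eq_integral do rewrite mul0e add0e.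
    by rewrite integralN ?int_c0 ?oppe0//; exact: integrable_add_def.
  have [int_b int_b0] := defect_integral fin_alpha fin_nu b_gt0 st_b.
  have [y0 y01 Dsign] := sign_change
    (fun u v u0 uv v1 => defect_convex fin_alpha fin_nu u0 uv (ltW v1)).
  exists y0 => //; split => //.
  rewrite intE integralB//; last exact: integrableZl.
  by rewrite integralZl// int_b0 int_c0 mule0 sube0.
have zero := weighted_zero b_lt_c y01 Dsign.1 (mG y0) Dsign.2.
have half0 : 0 < 2^-1 :> R by rewrite invr_gt0 ltr0n.
have half1 : 2^-1 < 1 :> R by rewrite invf_lt1 ?ltr0n// ltr1n.
(* One zero of D in each half of ]0, 1[ provides the two distinct zeros for [defect_eq0]. *)
have [u /andP[u0 u1] Du] := zero 0 2^-1 (lexx 0) half0 (ltW half1).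
have [v /andP[v0 v1] Dv] := zero 2^-1 1 (ltW half0) half1 (lexx 1).
exact: (defect_eq0 fin_alpha fin_nu u0 (lt_trans u1 v0) (ltW v1) Du Dv).
Qed.
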